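(* Let $\mathfrak{A}$ be a unital $C^*$-algebra and $a\in\mathfrak{A}$. Then $\mathscr{L}_{\mu}^{\mathfrak{A}}(a)$ is a convex set in $\mathbb{R}$ for each $\mu\in W_{\mathfrak{A}}(a)$.
   Context: $\mathfrak{A}$ is a complex, nonzero, unital $C^*$-algebra with unit $\boldsymbol{1}$; its state space $\mathfrak{S}(\mathfrak{A})$ is the set of all positive linear functionals $f\in\mathfrak{A}^*$ with $\|f\|=f(\boldsymbol{1})=1$. For $a\in\mathfrak{A}$: the algebraic numerical range is $W_{\mathfrak{A}}(a)=\{f(a):f\in\mathfrak{S}(\mathfrak{A})\}$; the algebraic Davis--Wielandt shell is $DW_{\mathfrak{A}}(a)=\{(f(a),f(a^*a)):f\in\mathfrak{S}(\mathfrak{A})\}\subset\mathbb{C}\times\mathbb{R}$; and for $\mu\in W_{\mathfrak{A}}(a)$, $\mathscr{L}_{\mu}^{\mathfrak{A}}(a)=\{r:(\mu,r)\in DW_{\mathfrak{A}}(a)\}\subseteq[0,\|a\|^2]$. *)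

(* Defs.v *)
From HB Require Import structures.
From mathcomp Require Import all_boot all_order all_algebra complex.
From mathcomp Require Import mathcomp_extra boolp classical_sets reals.
From mathcomp Require Import interval_inference topology normedtype convex.

Set Implicit Arguments.
Unset Strict Implicit.
Unset Printing Implicit Defensive.

Import Order.TTheory GRing.Theory Num.Theory.
Import numFieldNormedType.Exports.

Local Open Scope classical_set_scope.
Local Open Scope ring_scope.
Local Open Scope complex_scope.

(* Nonzero unital C*-algebras. The product is a field of the mixin because
   Hierarchy Builder rejects a join of normed modules and rings that is declared
   after numDomainType; the algType structure is recovered by the instances
   below. The norm takes its (nonnegative real) values in the scalar field. *)
HB.mixin Record isCStarAlgebra (K : numClosedFieldType) A
    of CompleteNormedModule K A := {
  cstar_one : A ;
  cstar_mul : A -> A -> A ;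
  cstar_mulA : associative cstar_mul ;
  cstar_mul1x : left_id cstar_one cstar_mul ;
  cstar_mulx1 : right_id cstar_one cstar_mul ;
  cstar_mulDl : left_distributive cstar_mul +%R ;
  cstar_mulDr : right_distributive cstar_mul +%R ;
  cstar_one_neq0 : cstar_one != 0 ;
  cstar_scaleAl : forall (c : K) (x y : A),
    c *: cstar_mul x y = cstar_mul (c *: x) y ;
  cstar_scaleAr : forall (c : K) (x y : A),
    c *: cstar_mul x y = cstar_mul x (c *: y) ;
  star : A -> A ;
  starK : involutive star ;
  starD : {morph star : x y / x + y} ;
  starZ : forall (c : K) (x : A), star (c *: x) = Num.conj c *: star x ;
  starM : forall x y : A, star (cstar_mul x y) = cstar_mul (star y) (star x) ;
  cstar_norm_submul : forall x y : A, `|cstar_mul x y| <= `|x| * `|y| ;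
  cstar_norm_starM : forall x : A, `|cstar_mul (star x) x| = `|x| ^+ 2 }.

#[short(type="cstarAlgType")]
HB.structure Definition CStarAlgebra (K : numClosedFieldType) :=
  {A of CompleteNormedModule K A & isCStarAlgebra K A}.

Section CStarAlgebraAlgType.
Context {K : numClosedFieldType} {A : cstarAlgType K}.

HB.instance Definition _ := GRing.Zmodule_isNzRing.Build A
  (@cstar_mulA K A) (@cstar_mul1x K A) (@cstar_mulx1 K A)
  (@cstar_mulDl K A) (@cstar_mulDr K A) (@cstar_one_neq0 K A).

HB.instance Definition _ := GRing.Lmodule_isLalgebra.Build K A
  (@cstar_scaleAl K A).

HB.instance Definition _ := GRing.Lalgebra_isAlgebra.Build K A
  (@cstar_scaleAr K A).

End CStarAlgebraAlgType.

Section AlgebraicDavisWielandtShell.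
Context {R : realType} {A : cstarAlgType R[i]}.
Implicit Types (f : {scalar A}) (a : A) (mu : R[i]).

(* The order of R[i] makes [0 <= z] mean that z is real and nonnegative. *)
Definition positive_functional f := forall x : A, 0 <= f (star x * x).

(* The operator norm of bounded functionals. Since [sup] is 0 on unbounded
   sets, [functional_norm f = 1] holds only for bounded [f]. *)
Definition functional_norm f : R :=
  sup [set complex.Re `|f x| | x in [set x : A | `|x| <= 1]].

Definition state_space : set {scalar A} :=
  [set f : {scalar A} |
    [/\ continuous (f : A -> R[i]^o), positive_functional f,
        functional_norm f = 1 & f 1 = 1]].

Definition algebraic_numerical_range a : set R[i] :=
  [set f a | f in state_space].

Definition algebraic_DW_shell a : set (R[i] * R) :=
  [set p | exists2 f, state_space f & p.1 = f a /\ p.2%:C = f (star a * a)].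

Definition DW_fiber mu a : set R := [set r | algebraic_DW_shell a (mu, r)].

End AlgebraicDavisWielandtShell.

(* Main.v *)
(* A convex combination of states is a state: its norm is at most 1 by the
   triangle inequality and is attained at the unit, which has norm 1. Mixing two
   states with the same value mu at a keeps that value and takes the convex
   combination of their values at a^* a. *)

Require Import Defs.
From mathcomp Require Import all_boot all_order all_algebra complex.
From mathcomp Require Import boolp classical_sets reals.
From mathcomp Require Import topology normedtype convex.
From HB Require Import structures.
From mathcomp Require Import interval_inference.

Import Order.TTheory GRing.Theory Num.Theory.
Import numFieldNormedType.Exports.

Local Open Scope classical_set_scope.
Local Open Scope ring_scope.
Local Open Scope complex_scope.

(** By [starM] and [starK], the adjoint of [1 * star 1] is [1 * star 1] again; cancelling units
    turns one side into [1] and the other into [star 1]. *)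
Lemma star1 (K : numClosedFieldType) (A : cstarAlgType K) : star 1 = 1 :> A.
Proof.
have := @starM K A 1 (star 1).
by rewrite starK !(cstar_mul1x (star 1)) starK => <-.
Qed.

(** The C*-identity at the unit makes this norm equal to its own square, and it is nonzero. *)
Lemma cstar_norm1 (K : numClosedFieldType) (A : cstarAlgType K) :
  `|1 : A| = 1.
Proof.
have := @cstar_norm_starM K A 1.
rewrite star1 (cstar_mul1x 1) -[LHS]mulr1 expr2 => /mulfI <- //.
by rewrite normr_eq0 cstar_one_neq0.
Qed.

Lemma state_norm_le1 (R : realType) (A : cstarAlgType R[i])
    (f : {scalar A}) (x : A) :
  state_space f -> `|x| <= 1 -> `|f x| <= 1.
Proof.
move=> [_ _ f1 _] x1.
set E := [set complex.Re `|f x| | x in [set x : A | `|x| <= 1]].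
(* A set without supremum would give the junk value sup E = 0. *)
have supE : has_sup E.
  apply: contrapT => /sup_out E0; move: f1; rewrite /functional_norm -/E E0.
  by move/eqP; rewrite eq_sym oner_eq0.
have : complex.Re `|f x| <= 1.
  by rewrite -f1; apply: (sup_upper_bound supE); exists x.
by rewrite -lecR RRe_real ?normr_real.
Qed.

(** Reduces the norm condition on a state to a pointwise bound on the unit ball, which passes to
    mixtures. *)
Lemma functional_norm_eq1 (R : realType) (A : cstarAlgType R[i])
    (f : {scalar A}) :
  f 1 = 1 -> (forall x, `|x| <= 1 -> `|f x| <= 1) -> functional_norm f = 1.
Proof.
move=> f1 fle1; set E := [set complex.Re `|f x| | x in [set x : A | `|x| <= 1]].
have E1 : E 1.
  exists 1; first by rewrite /= cstar_norm1.
  by rewrite f1; exact: (congr1 (@complex.Re R) (normr1 R[i])).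
have ubE : ubound E 1.
  move=> _ [x /= x1 <-]; have := fle1 x x1.
  by rewrite -(@RRe_real _ `|f x|) ?normr_real// lecR.
apply/eqP; rewrite eq_le; apply/andP; split.
  exact: ge_sup (ex_intro _ 1 E1) ubE.
exact: (ub_le_sup (ex_intro _ 1 ubE)).
Qed.

Section MixFunctional.
Context {K : numClosedFieldType} {A : cstarAlgType K}.

Definition mix_functional (t : K) (f g : {scalar A}) (x : A) : K :=
  t * f x + (1 - t) * g x.

Fact mix_functional_scalar t f g : scalar (mix_functional t f g).
Proof.
move=> c x y; rewrite /mix_functional !linearP /= !mulrDr addrACA.
by rewrite !(mulrCA c).
Qed.

HB.instance Definition _ t f g :=
  GRing.isLinear.Build K A K *%R (mix_functional t f g)
    (mix_functional_scalar t f g).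

End MixFunctional.

Lemma state_space_mix (R : realType) (A : cstarAlgType R[i]) (t : R)
    (f g : {scalar A}) :
  0 <= t -> t <= 1 -> state_space f -> state_space g ->
  state_space (mix_functional t%:C f g : {scalar A}).
Proof.
move=> t0 t1 sf sg; have [fc fp _ f1] := sf; have [gc gp _ g1] := sg.
have tC0 : 0 <= t%:C by rewrite ler0c.
have tC1 : 0 <= 1 - t%:C by rewrite subr_ge0 (lecR t 1).
have mix1 : mix_functional t%:C f g 1 = 1.
  by rewrite /mix_functional f1 g1 !mulr1 addrC subrK.
split => //.
(* Products by the weights are read as scalings in [R[i]^o], where continuity of sums and scalings
   applies. *)
- move=> x; apply: (@continuousD R[i] R[i]^o A
    (fun x => t%:C *: (f x : R[i]^o)) (fun x => (1 - t%:C) *: (g x : R[i]^o))).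
  + by apply: continuousZl_tmp; exact: fc.
  + by apply: continuousZl_tmp; exact: gc.
- by move=> x; rewrite addr_ge0 ?mulr_ge0 ?fp ?gp.
- apply: functional_norm_eq1 => // x x1; rewrite (le_trans (ler_normD _ _))//.
  rewrite !normrM (ger0_norm tC0) (ger0_norm tC1).
  (* The bound [1] is split as [t + (1 - t)] and compared with the two terms separately. *)
  rewrite -[leRHS](subrKC t%:C) lerD// ler_piMr//; exact: state_norm_le1.
Qed.

Theorem theorem2p5 (R : realType) (A : cstarAlgType R[i]%type) (a : A)
    (mu : R[i]%type) (hmu : algebraic_numerical_range a mu) :
  @convex_set R R^o%type (DW_fiber mu a).
Proof.
move=> r s t /set_mem[f sf [/= fa fr]] /set_mem[g sg [/= ga gs]]; apply/mem_set.
exists (mix_functional t%:num%:C f g : {scalar A}).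
  (* The bounds [0 <= t <= 1] are carried by the type of [t]. *)
  by apply: state_space_mix.
split => /=; rewrite /mix_functional.
  by rewrite -fa -ga -mulrDl subrKC mul1r.
(* The embedding of [R] in [R[i]] is a ring morphism, so it preserves the convex combination. *)
by rewrite -fr -gs rmorphD !rmorphM rmorphB.
Qed.
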